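(* For each $n\ge1$ consider a noisy voter model $\mathrm{NVM}(V_n,P_n,p_n)$ with $|V_n|=n$, where $P_n$ is an irreducible transition matrix on $V_n$ with stationary distribution $\pi_n$, $p_n\in(0,1]$, and $(p_n)$ is non-increasing. Let $M_n$ be the meeting time of two independent continuous-time random walks on $V_n$, each moving at rate $1$ according to $P_n$, started from independent positions with law $\pi_n$. If $p_n\,\mathbb E(M_n)\to0$ as $n\to\infty$, then $\sigma_n^2\to1/4$ and $S_n$ converges in distribution to a Bernoulli random variable of parameter $1/2$.
   Context: Noisy voter model: let $V$ be a finite set, $P$ an irreducible transition (stochastic) matrix on $V$ with stationary distribution $\pi$, and $p\in(0,1]$. $\mathrm{NVM}(V,P,p)$ is the discrete-time Markov chain on $\{0,1\}^V$ which at each step chooses a vertex $x\in V$ uniformly at random and updates only its opinion: with probability $p$ the opinion of $x$ is replaced by a fair coin flip in $\{0,1\}$; otherwise, with probability $1-p$, a vertex $y$ is chosen with probability $P(x,y)$ and the opinion of $x$ is replaced by the current opinion of $y$. For $p>0$ it has a unique stationary distribution $\Gamma$. With $\xi\sim\Gamma$, set $S=\sum_{x\in V}\pi(x)\xi(x)$ and $\sigma^2=\mathrm{Var}(S)$. A subscript $n$ denotes these quantities for $\mathrm{NVM}(V_n,P_n,p_n)$. The meeting time of two walks is the first time $t\ge0$ at which they occupy the same vertex. *)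

(* Defs.v *)
From HB Require Import structures.
From mathcomp Require Import all_boot all_order all_algebra.
From mathcomp Require Import all_classical all_reals all_analysis.

Set Implicit Arguments.
Unset Strict Implicit.
Unset Printing Implicit Defensive.
Import Order.TTheory GRing.Theory Num.Theory.
Import numFieldNormedType.Exports.
Local Open Scope classical_set_scope.
Local Open Scope ring_scope.

Definition stochastic (R : realType) (T : finType) (K : T -> T -> R) : Prop :=
  (forall x y, 0 <= K x y) /\ (forall x, \sum_y K x y = 1).

Fixpoint iter_kernel (R : realType) (T : finType) (K : T -> T -> R) (k : nat)
    (x y : T) : R :=
  if k is k'.+1 then \sum_z K x z * iter_kernel K k' z y else (x == y)%:R.

Definition irreducible_kernel (R : realType) (T : finType) (K : T -> T -> R) :
    Prop :=
  forall x y, exists k, 0 < iter_kernel K k x y.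

Definition stationary_distribution (R : realType) (T : finType)
    (K : T -> T -> R) (m : T -> R) : Prop :=
  [/\ forall x, 0 <= m x, \sum_x m x = 1 &
      forall y, \sum_x m x * K x y = m y].

Definition set_opinion (V : finType) (c : {ffun V -> bool}) (x : V) (b : bool) :
    {ffun V -> bool} :=
  [ffun z => if z == x then b else c z].

Definition nvm_kernel (R : realType) (V : finType) (P : V -> V -> R) (p : R)
    (c c' : {ffun V -> bool}) : R :=
  \sum_x #|V|%:R^-1 *
    (p * (\sum_(b : bool) 2^-1 * (c' == set_opinion c x b)%:R)
     + (1 - p) * (\sum_y P x y * (c' == set_opinion c x (c y))%:R)).

(* The function [xi] need not be bundled as a random variable: [{ffun V -> bool}]
   is regarded as a discrete space, so measurability is that of its fibres. *)
Definition has_law (R : realType) (d : measure_display) (T : measurableType d)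
    (Q : probability T R) (C : finType) (xi : T -> C) (m : C -> R) : Prop :=
  forall c, measurable (xi @^-1` [set c]) /\ Q (xi @^-1` [set c]) = (m c)%:E.

Definition weighted_opinion (R : realType) (V : finType) (w : V -> R)
    (c : {ffun V -> bool}) : R :=
  \sum_x w x * (c x)%:R.

(* Transition function exp(t(P - I)) of the walk which jumps according to [P] at
   the times of a rate 1 Poisson process.  The library's [poisson_pmf] is not
   used because its value at rate 0 is not that of the Dirac mass at 0. *)
Definition ctrw_transition (R : realType) (V : finType) (P : V -> V -> R)
    (t : R) (x y : V) : R :=
  limn (series (fun k : nat => expR (- t) * t ^+ k / k`!%:R * iter_kernel P k x y)).

(* Continuous-time random walk with jump rate 1, jump matrix [P] and initial
   law [m].  Time is [0, +oo[ inside [R]; negative times are never looked at. *)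
Definition ct_random_walk (R : realType) (d : measure_display)
    (T : measurableType d) (Pr : probability T R) (V : finType)
    (P : V -> V -> R) (m : V -> R) (X : R -> T -> V) : Prop :=
  [/\ forall t x, 0 <= t -> measurable (X t @^-1` [set x]),
      forall w t, 0 <= t -> \forall s \near t^'+, X s w = X t w &
      forall (k : nat) (t : nat -> R) (x : nat -> V),
        t 0%N = 0 -> (forall i, (i < k)%N -> t i <= t i.+1) ->
        Pr (\bigcap_(i in `I_k.+1) (X (t i) @^-1` [set x i])) =
        (m (x 0%N) *
         \prod_(i < k) ctrw_transition P (t i.+1 - t i) (x i) (x i.+1))%:E].

Definition process_sigma_algebra (R : realType) (T : Type) (V : finType)
    (X : R -> T -> V) : set (set T) :=
  <<s [set A | exists t x, 0 <= t /\ A = X t @^-1` [set x]] >>.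

Definition independent_processes (R : realType) (d : measure_display)
    (T : measurableType d) (Pr : probability T R) (V : finType)
    (X Y : R -> T -> V) : Prop :=
  forall A B, process_sigma_algebra X A -> process_sigma_algebra Y B ->
    Pr (A `&` B) = (Pr A * Pr B)%E.

(* Equal to [+oo] when the walks never meet. *)
Definition meeting_time (R : realType) (T : Type) (V : finType)
    (X Y : R -> T -> V) (w : T) : \bar R :=
  ereal_inf [set t%:E | t in [set t : R | 0 <= t /\ X t w = Y t w]].

Definition cvg_in_distribution (R : realType) (d : nat -> measure_display)
    (T : forall n, measurableType (d n)) (Q : forall n, probability (T n) R)
    (S : forall n, T n -> R) (d' : measure_display) (T' : measurableType d')
    (Q' : probability T' R) (Z : T' -> R) : Prop :=
  forall f : R -> R, continuous f -> (exists C, forall x, `|f x| <= C) ->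
    ('E_(Q n)[f \o @S n])%E @[n --> \oo] --> ('E_Q'[f \o Z])%E.

(* Main.v *)
Require Import Defs.
From mathcomp Require Import all_boot all_order all_algebra.
From mathcomp Require Import all_classical all_reals all_analysis.
From mathcomp Require Import measurable_realfun ring lra.

Set Implicit Arguments.
Unset Strict Implicit.
Unset Printing Implicit Defensive.
Import Order.TTheory GRing.Theory Num.Theory.
Import numFieldNormedType.Exports.
Local Open Scope classical_set_scope.
Local Open Scope ring_scope.

(** The sum [S] is a [0, 1]-valued variable of mean [1/2], so that both claims
    reduce to [E (S (1 - S)) --> 0]: the variance is [1/4 - E (S (1 - S))]
    ([variance_law]), and a continuous function differs from its chord on
    [0, 1] by at most [e + C s (1 - s)] ([chord_distance_le]), so that
    [E (f S)] is close to [(f 0 + f 1) / 2].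

    Let [D x y] be the stationary probability that [x] and [y] disagree.  Then
    [2 E (S (1 - S))] is the mean of [D] under [pi (x) pi]
    ([mean_weighted_opinion_variation]), that is, the value of [D] at the
    starting points of the two walks, and it remains to bound it by [p E M],
    where [M] is the meeting time.  Heuristically, following opinions backwards
    turns [D] into half the probability that one of two walks is reset by noise
    before they meet; each walk is reset at rate [p].  The proof replaces this
    duality by a martingale argument.  Stationarity of the voter model under
    one update gives [- L D <= p], where [L] is the generator of the pair of
    walks ([disagreement_drift]).  Since [D] vanishes on the diagonal, stopping
    at the meeting time or at time [t], whichever comes first, yields
    [E D (X 0, Y 0) <= p E (min M t) + Pr (M > t)], and [t --> +oo] gives
    [p E M] by Markov's inequality.

    The stopping argument is carried out on time grids, where the pair of walks
    is a finite Markov chain whose law is explicit.  There the drift of [D] in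
    one step of length [t] is at least [- (p t + 4 t ^ 2)]
    ([pair_transition_drift]), because a walk makes no jump with probability
    [exp (- t)] and exactly one with probability [t exp (- t)].  Along the grids
    of mesh [h / 2 ^ j] the quadratic errors vanish, and the events that no
    meeting is seen on the grid decrease to an event on which the true meeting
    time is late, by right-continuity of the paths ([meeting_time_ge]). *)

(** * Stationary identities of the noisy voter model *)

Section StationaryVoterModel.
Context (R : realType) (V : finType) (P : V -> V -> R) (p : R)
  (Gamma : {ffun V -> bool} -> R).

Lemma stationary_kernel_mean (T : finType) (K : T -> T -> R) (m : T -> R)
    (g : T -> R) :
  stationary_distribution K m ->
  \sum_c m c * (\sum_c' K c c' * g c') = \sum_c m c * g c.
Proof.
move=> [_ _ mK]; under eq_bigr do rewrite big_distrr/=.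
rewrite exchange_big/=; apply: eq_bigr => c' _.
by rewrite -mK big_distrl/=; apply: eq_bigr => c _; rewrite mulrA.
Qed.

Lemma sum_indicator (T : finType) (g : T -> R) (a : T) :
  \sum_c (c == a)%:R * g c = g a.
Proof.
rewrite (bigD1 a)//= eqxx mul1r big1 ?addr0// => c /negPf ->.
by rewrite mul0r.
Qed.

Lemma nvm_kernel_mean (g : {ffun V -> bool} -> R) (c : {ffun V -> bool}) :
  \sum_c' nvm_kernel P p c c' * g c' =
  \sum_x #|V|%:R^-1 *
    (p * (\sum_(b : bool) 2^-1 * g (set_opinion c x b))
     + (1 - p) * (\sum_y P x y * g (set_opinion c x (c y)))).
Proof.
under eq_bigr do rewrite big_distrl/=.
rewrite exchange_big/=; apply: eq_bigr => x _.
under eq_bigr do rewrite -mulrA.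
rewrite -big_distrr/=; congr (_ * _).
under eq_bigr do rewrite mulrDl.
rewrite big_split/=; congr (_ + _).
  under eq_bigr do rewrite -mulrA big_distrl/=.
  rewrite -big_distrr/= exchange_big/=; congr (_ * _); apply: eq_bigr => b _.
  under eq_bigr do rewrite -mulrA.
  by rewrite -big_distrr/= sum_indicator.
under eq_bigr do rewrite -mulrA big_distrl/=.
rewrite -big_distrr/= exchange_big/=; congr (_ * _); apply: eq_bigr => y _.
under eq_bigr do rewrite -mulrA.
by rewrite -big_distrr/= sum_indicator.
Qed.

Hypothesis V_gt0 : (0 < #|V|)%N.
Hypothesis P_stoch : stochastic P.
Hypothesis Gamma_stat : stationary_distribution (nvm_kernel P p) Gamma.

(** The mean change of [g] when [x] is the updated vertex. *)
Definition nvm_drift (g : {ffun V -> bool} -> R) (c : {ffun V -> bool}) (x : V) :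
    R :=
  p * (\sum_(b : bool) 2^-1 * (g (set_opinion c x b) - g c))
  + (1 - p) * (\sum_y P x y * (g (set_opinion c x (c y)) - g c)).

Lemma nvm_stationary_drift (g : {ffun V -> bool} -> R) :
  \sum_c Gamma c * (\sum_x nvm_drift g c x) = 0.
Proof.
have /esym/eqP := stationary_kernel_mean g Gamma_stat.
rewrite -subr_eq0 -sumrB => /eqP S0.
apply: (@mulfI R (- #|V|%:R^-1)).
  by rewrite oppr_eq0 invr_neq0// pnatr_eq0 -lt0n.
rewrite mulr0 -[RHS]S0 big_distrr/=; apply: eq_bigr => c _.
rewrite mulrCA -mulrBr; congr (_ * _).
have -> : g c = \sum_(x : V) #|V|%:R^-1 * g c.
  rewrite sumr_const -(mulr_natl (_ * _)) mulrA divff ?mul1r//.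
  by rewrite pnatr_eq0 -lt0n.
rewrite nvm_kernel_mean -sumrB big_distrr/=; apply: eq_bigr => x _.
rewrite -mulrBr mulNr -mulrN; congr (_ * _).
rewrite /nvm_drift.
have -> : \sum_(b : bool) 2^-1 * (g (set_opinion c x b) - g c) =
    (\sum_(b : bool) 2^-1 * g (set_opinion c x b)) - g c.
  by rewrite !big_bool/=; lra.
have -> : \sum_y P x y * (g (set_opinion c x (c y)) - g c) =
    (\sum_y P x y * g (set_opinion c x (c y))) - g c.
  under eq_bigr do rewrite mulrBr.
  by rewrite sumrB -big_distrl/= (proj2 P_stoch) mul1r.
by ring.
Qed.

Definition disagreement (x y : V) : R := \sum_c Gamma c * (c x != c y)%:R.

Lemma disagreement_ge0 x y : 0 <= disagreement x y.
Proof. by case: Gamma_stat => G0 _ _; apply: sumr_ge0 => c _; exact: mulr_ge0. Qed.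

Lemma disagreement_le1 x y : disagreement x y <= 1.
Proof.
case: Gamma_stat => G0 G1 _; rewrite -G1; apply: ler_sum => c _.
by rewrite ler_piMr// lern1; case: (_ != _).
Qed.

Lemma disagreement_diag x : disagreement x x = 0.
Proof. by apply: big1 => c _; rewrite eqxx mulr0. Qed.

Hypothesis p01 : 0 < p <= 1.

(** Only updates of [u] and of [v] affect whether [u] and [v] disagree: a coin
    flip makes them disagree with probability [1/2], and a copy at [u] of the
    opinion of [z] replaces [disagreement u v] by [disagreement z v].  As the
    mean change is zero, [2 D = p + (1 - p) (P D + D P^T)] off the diagonal, where
    [p (P D + D P^T)] is nonnegative.  On the diagonal the bound holds because
    the left-hand side vanishes, so that no boundary term appears when the
    pair of walks is stopped. *)
Lemma disagreement_drift u v :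
  2 * disagreement u v <=
  p + \sum_z P u z * disagreement z v + \sum_z P v z * disagreement u z.
Proof.
have [P0 P1] := P_stoch; have [G0 G1 _] := Gamma_stat.
have /andP[p0 p1] := p01.
have K1 : 0 <= \sum_z P u z * disagreement z v.
  by apply: sumr_ge0 => z _; rewrite mulr_ge0 ?disagreement_ge0.
have K2 : 0 <= \sum_z P v z * disagreement u z.
  by apply: sumr_ge0 => z _; rewrite mulr_ge0 ?disagreement_ge0.
have [uv|uv] := eqVneq u v.
  have D0 : disagreement u v = 0 by rewrite uv disagreement_diag.
  by rewrite D0; lra.
suff H : 2 * disagreement u v = p + (1 - p) *
    (\sum_z P u z * disagreement z v + \sum_z P v z * disagreement u z).
  by have := mulr_ge0 (ltW p0) (addr_ge0 K1 K2); rewrite H; lra.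
pose g (c : {ffun V -> bool}) : R := (c u != c v)%:R.
have E c : \sum_x nvm_drift g c x = p - 2 * g c + (1 - p) *
    (\sum_z P u z * (c z != c v)%:R + \sum_z P v z * (c u != c z)%:R).
  rewrite (bigD1 u)//= (bigD1 v)/=; last by rewrite eq_sym.
  rewrite big1 ?addr0; last first.
    move=> x /andP[xu xv].
    have gE b : g (set_opinion c x b) = g c.
      by rewrite /g !ffunE (eq_sym u) (negPf xu) (eq_sym v) (negPf xv).
    rewrite /nvm_drift !big1 ?mulr0 ?addr0// => b _;
    by rewrite gE subrr mulr0.
  have gu b : g (set_opinion c u b) = (b != c v)%:R.
    by rewrite /g !ffunE eqxx (eq_sym v) (negPf uv).
  have gv b : g (set_opinion c v b) = (c u != b)%:R.
    by rewrite /g !ffunE eqxx (negPf uv).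
  rewrite /nvm_drift.
  under [X in _ + (1 - p) * X + _]eq_bigr do rewrite gu mulrBr.
  under [X in _ + (_ + (1 - p) * X)]eq_bigr do rewrite gv mulrBr.
  rewrite !sumrB -!big_distrl/= !P1 !big_bool/= !gu !gv.
  by rewrite /g; case: (c u); case: (c v) => /=; field.
have := nvm_stationary_drift g.
under eq_bigr do rewrite E mulrDr mulrBr mulrCA (mulrCA _ (1 - p)).
rewrite big_split/= sumrB -big_distrl -!big_distrr/= G1.
rewrite -[X in _ - 2 * X]/(disagreement u v).
under eq_bigr do rewrite mulrDr !big_distrr/=.
rewrite big_split/= exchange_big/= [X in _ * (_ + X)]exchange_big/=.
under eq_bigr do
  (under eq_bigr do rewrite mulrCA; rewrite -big_distrr/= -/(disagreement _ _)).
under [X in _ * (_ + X)]eq_bigr do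
  (under eq_bigr do rewrite mulrCA; rewrite -big_distrr/= -/(disagreement _ _)).
by move=> H; lra.
Qed.

Context (pi_ : V -> R).
Hypothesis pi_stat : stationary_distribution P pi_.

Lemma weighted_opinion_itv c : 0 <= weighted_opinion pi_ c <= 1.
Proof.
have [pi0 pi1 _] := pi_stat; apply/andP; split.
  by apply: sumr_ge0 => x _; exact: mulr_ge0.
by rewrite -pi1; apply: ler_sum => x _; rewrite ler_piMr// lern1 leq_b1.
Qed.

(** Copying preserves the mean of [weighted_opinion pi_] because [pi_] is
    stationary for [P], so its drift [p (1/2 - S)] comes from the noise alone;
    the mean drift is zero and [p] is positive. *)
Lemma mean_weighted_opinion : \sum_c Gamma c * weighted_opinion pi_ c = 2^-1.
Proof.
have [P0 P1] := P_stoch; have [G0 G1 _] := Gamma_stat.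
have [pi0 pi1 piP] := pi_stat; have /andP[p0 p1] := p01.
have set_mean c x b : weighted_opinion pi_ (set_opinion c x b) =
    weighted_opinion pi_ c + pi_ x * (b%:R - (c x)%:R).
  rewrite /weighted_opinion (bigD1 x)//= [in RHS](bigD1 x)//= ffunE eqxx.
  under eq_bigr => y /negPf yx do rewrite ffunE yx.
  by ring.
have E c : \sum_x nvm_drift (weighted_opinion pi_) c x =
    p * (2^-1 - weighted_opinion pi_ c).
  transitivity (\sum_x (p * (2^-1 * pi_ x) - pi_ x * (c x)%:R
      + (1 - p) * (\sum_y pi_ x * P x y * (c y)%:R))).
    apply: eq_bigr => x _; rewrite /nvm_drift !big_bool/= !set_mean.
    under eq_bigr do rewrite set_mean addrAC subrr add0r mulrCA mulrBr mulrBr mulrA.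
    rewrite sumrB -big_distrr/= -big_distrl/= P1 mul1r.
    by rewrite /=; field.
  rewrite big_split/= sumrB -!big_distrr/= pi1 exchange_big/=.
  under [X in _ + _ * X]eq_bigr do rewrite -big_distrl/= piP.
  by rewrite /weighted_opinion; ring.
have := nvm_stationary_drift (weighted_opinion pi_).
under eq_bigr do rewrite E mulrCA mulrBr.
rewrite -big_distrr/= sumrB -big_distrl/= G1 mul1r => /eqP.
by rewrite mulf_eq0 gt_eqF//= subr_eq0 => /eqP.
Qed.

(** For a fixed configuration, [2 S (1 - S)] is the [pi_]-probability that two
    independent vertices carry different opinions. *)
Lemma mean_weighted_opinion_variation :
  2 * (\sum_c Gamma c * (weighted_opinion pi_ c * (1 - weighted_opinion pi_ c))) =
  \sum_x \sum_y pi_ x * pi_ y * disagreement x y.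
Proof.
have [pi0 pi1 piP] := pi_stat.
have E c : 2 * (weighted_opinion pi_ c * (1 - weighted_opinion pi_ c)) =
    \sum_x \sum_y pi_ x * pi_ y * (c x != c y)%:R.
  pose s := weighted_opinion pi_ c.
  transitivity (\sum_x (pi_ x * (c x)%:R * (1 - s) + pi_ x * (1 - (c x)%:R) * s)).
    rewrite big_split/= -!big_distrl/=.
    under [X in _ + X * _]eq_bigr do rewrite mulrBr mulr1.
    by rewrite sumrB pi1 /s /weighted_opinion; ring.
  have -> : 1 - s = \sum_y pi_ y * (1 - (c y)%:R).
    by under eq_bigr do rewrite mulrBr mulr1; rewrite sumrB pi1.
  apply: eq_bigr => x _.
  rewrite /s /weighted_opinion !big_distrr/= -big_split/=.
  by apply: eq_bigr => y _; case: (c x); case: (c y) => /=; ring.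
rewrite big_distrr/=.
under eq_bigr do rewrite mulrCA E big_distrr/=.
rewrite exchange_big/=; apply: eq_bigr => x _.
under eq_bigr do rewrite big_distrr/=.
rewrite exchange_big/=; apply: eq_bigr => y _.
by under eq_bigr do rewrite mulrCA; rewrite -big_distrr.
Qed.

End StationaryVoterModel.

(** * A finite Markov chain before its exit from a set *)

Section AvoidingMarkovChain.
Context (R : realType) (d : measure_display) (T : measurableType d)
  (Pr : probability T R) (W : finType).

Lemma measurable_fin_preimage (f : T -> W) (S : set W) :
  (forall u, measurable (f @^-1` [set u])) -> measurable (f @^-1` S).
Proof.
move=> mf; rewrite (_ : f @^-1` S = \bigcup_(u in S) f @^-1` [set u]).
  by apply: fin_bigcup_measurable => //; exact: finite_finset.
by apply/seteqP; split=> [w Sw|w [u Su /= fwu]]; [exists (f w)|rewrite /= fwu].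
Qed.

Lemma probability_fin_partition (f : T -> W) (A : set T) :
  (forall u, measurable (f @^-1` [set u])) -> measurable A ->
  Pr A = (\sum_u Pr (A `&` f @^-1` [set u]))%E.
Proof.
move=> mf mA; have mAf u : measurable (A `&` f @^-1` [set u]) by exact: measurableI.
transitivity (\sum_u \int[Pr]_w (\1_(A `&` f @^-1` [set u]) w : R)%:E)%E; last first.
  by apply: eq_bigr => u _; rewrite integral_indic// setIT.
rewrite -ge0_integral_sum//=; last first.
  by move=> u; apply/measurable_EFinP; exact: measurable_indic.
rewrite -[A in LHS]setIT -integral_indic//.
apply: eq_integral => w _; rewrite sumEFin; congr (_%:E).
rewrite (bigD1 (f w))//= big1 ?addr0.
  by rewrite !indicE in_setI [in RHS](mem_set (A := f @^-1` _)) ?andbT.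
move=> u fwu; rewrite indicE memNset// => -[_ /= uE].
by rewrite uE eqxx in fwu.
Qed.

Context (Z : nat -> T -> W) (m : W -> R) (q : W -> W -> R) (off : pred W).
Hypothesis mZ : forall i u, measurable (Z i @^-1` [set u]).
Hypothesis Z_law : forall k (z : nat -> W),
  Pr [set w | forall i, (i <= k)%N -> Z i w = z i] =
  (m (z 0%N) * \prod_(i < k) q (z i) (z i.+1))%:E.

Lemma measurable_cylinder (S : nat -> set W) (k : nat) :
  measurable [set w | forall i, (i < k)%N -> S i (Z i w)].
Proof.
rewrite (_ : mkset _ = \bigcap_(i in `I_k) Z i @^-1` S i).
  by apply: bigcap_measurableType => i _; exact: measurable_fin_preimage.
by apply/seteqP; split.
Qed.

Definition avoid (j : nat) : set T := [set w | forall i, (i < j)%N -> off (Z i w)].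

Lemma measurable_avoid j : measurable (avoid j).
Proof. exact: (measurable_cylinder (fun=> [set u | off u])). Qed.

(** The sub-probability vector of the chain at step [j], killed at its first visit
    outside [off] before that step; see [avoid_weightE]. *)
Fixpoint avoid_weight (j : nat) (v : W) : R :=
  if j is i.+1 then \sum_(u | off u) avoid_weight i u * q u v else m v.

(** The Markov property enters here.  Keeping a prescribed path after step [j]
    lets the induction on [j] consume the path formula one vertex at a time, by
    summing over the vertex visited at step [j]. *)
Lemma avoid_then_path j k (z : nat -> W) : (j <= k)%N ->
  Pr [set w | forall i, (i < k.+1)%N ->
        (if (i < j)%N then [set u | off u] else [set z i]) (Z i w)] =
  (avoid_weight j (z j) * \prod_(j <= i < k) q (z i) (z i.+1))%:E.
Proof.
elim: j z => [|j IH] z jk; first by rewrite big_mkord -Z_law.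
pose S i := if (i < j.+1)%N then [set u | off u] else [set z i].
rewrite -[mkset _]/[set w | forall i, (i < k.+1)%N -> S i (Z i w)].
set A := [set w | _].
have mA : measurable A := measurable_cylinder S k.+1.
rewrite (probability_fin_partition (mZ j) mA) big_distrl/= -sumEFin [RHS]big_mkcond.
apply: eq_bigr => u _; case: ifPn => offu; last first.
  rewrite (_ : _ `&` _ = set0) ?measure0//.
  apply/seteqP; split => // w [/= Aw Zj].
  have := Aw j; rewrite /S ltnSn ltnS (ltnW jk) => /(_ isT) /=.
  by rewrite Zj (negPf offu).
(* The last vertex visited before the prescribed path starts is [u]. *)
pose z' i := if i == j then u else z i.
have z'E i : (j < i)%N -> z' i = z i by move=> ji; rewrite /z' gtn_eqF.
have z'j : z' j = u by rewrite /z' eqxx.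
rewrite (_ : A `&` _ = [set w | forall i, (i < k.+1)%N ->
    (if (i < j)%N then [set u | off u] else [set z' i]) (Z i w)]).
  rewrite IH 1?ltnW// z'j [in LHS]big_ltn// z'j z'E// mulrA; congr (_ * _)%:E.
  by apply: eq_big_nat => i /andP[ji _]; rewrite !z'E// ltnW.
apply/seteqP; split => w.
  move=> [Aw /= Zj] i ik; have := Aw i ik; rewrite /S ltnS leq_eqVlt.
  have [->|ij] := eqVneq i j; first by rewrite ltnn z'j.
  by rewrite /= /z' (negPf ij).
move=> /= H; have Zj : Z j w = u.
  by have := H j; rewrite ltnn ltnS ltnW//= z'j => /(_ isT).
split=> // i ik; rewrite /S ltnS leq_eqVlt; have := H i ik.
have [->|ij] := eqVneq i j; first by rewrite /= Zj.
by rewrite /= /z' (negPf ij).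
Qed.

Lemma avoid_weightE j v : Pr (avoid j `&` Z j @^-1` [set v]) = (avoid_weight j v)%:E.
Proof.
have := avoid_then_path (fun=> v) (leqnn j); rewrite big_geq// mulr1 => <-.
congr (Pr _); apply/seteqP; split => w /=.
  move=> [Aw Zj] i; rewrite ltnS leq_eqVlt => /predU1P[->|ij].
    by rewrite ltnn.
  by rewrite ij; exact: Aw.
move=> H; split=> [i ij|]; first by have := H i (ltnW ij); rewrite ij.
by have := H j (ltnSn j); rewrite ltnn.
Qed.

Lemma avoid_weight_ge0 j v : 0 <= avoid_weight j v.
Proof. by rewrite -lee_fin -avoid_weightE measure_ge0. Qed.

Lemma probability_avoid j :
  Pr (avoid j.+1) = (\sum_(v | off v) avoid_weight j v)%:E.
Proof.
rewrite (probability_fin_partition (mZ j) (measurable_avoid j.+1)).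
rewrite -sumEFin [RHS]big_mkcond; apply: eq_bigr => v _; case: ifPn => offv.
  rewrite -avoid_weightE; congr (Pr _); apply/seteqP; split => w [Aw /= Zj].
    by split=> // i ij; apply: Aw; exact: ltnW.
  split=> // i; rewrite ltnS leq_eqVlt => /predU1P[->|]; last exact: Aw.
  by rewrite Zj.
rewrite (_ : _ `&` _ = set0) ?measure0//.
apply/seteqP; split => // w [/(_ j (ltnSn j)) + /= Zj].
by rewrite Zj (negPf offv).
Qed.

(** Optional stopping at the exit from [off] or at step [k]: each step spent in
    [off] costs at most [e], and [D] is worth nothing after the exit and at most
    one if the exit has not occurred. *)
Lemma stopped_mean_le (D : W -> R) (e : R) (k : nat) :
  (forall v, D v <= 1) -> (forall v, ~~ off v -> D v = 0) ->
  (forall v, D v - e <= \sum_u q v u * D u) ->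
  \sum_v m v * D v <=
  fine (Pr (avoid k.+1)) + e * \sum_(i < k) fine (Pr (avoid i.+1)).
Proof.
move=> D1 D0 qD.
have sum_off (g : W -> R) : \sum_v g v * D v = \sum_(v | off v) g v * D v.
  by rewrite [RHS]big_mkcond; apply: eq_bigr => v _; case: ifPn => // /D0 ->;
     rewrite mulr0.
have -> : \sum_v m v * D v = \sum_(v | off v) avoid_weight 0 v * D v.
  exact: sum_off.
have step j : \sum_(v | off v) avoid_weight j v * D v <=
    \sum_(v | off v) avoid_weight j.+1 v * D v + e * fine (Pr (avoid j.+1)).
  rewrite -(sum_off (avoid_weight j.+1)) probability_avoid/=.
  under [X in X + _]eq_bigr do rewrite big_distrl/=.
  rewrite exchange_big/= big_distrr/= -big_split/=.
  apply: ler_sum => v _; under eq_bigr do rewrite -mulrA.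
  rewrite -big_distrr/= [e * _]mulrC -mulrDr ler_wpM2l ?avoid_weight_ge0//.
  by rewrite -lerBlDr.
have : \sum_(v | off v) avoid_weight 0 v * D v <=
    \sum_(v | off v) avoid_weight k v * D v
      + e * \sum_(i < k) fine (Pr (avoid i.+1)).
  elim: k => [|k IH]; first by rewrite big_ord0 mulr0 addr0.
  by rewrite big_ord_recr/= mulrDr; have := step k; lra.
move=> /le_trans; apply; rewrite lerD2r probability_avoid/=.
by apply: ler_sum => v _; rewrite ler_piMr ?avoid_weight_ge0.
Qed.

End AvoidingMarkovChain.

(** * Short-time transitions of the walks *)

Section ContinuousTimeWalk.
Context (R : realType) (V : finType) (P : V -> V -> R).
Hypothesis P_stoch : stochastic P.

Lemma iter_kernel_itv k x y : 0 <= iter_kernel P k x y <= 1.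
Proof.
have [P0 P1] := P_stoch; elim: k x => [|k IH] x /=.
  by rewrite ler0n lern1 leq_b1.
apply/andP; split.
  by apply: sumr_ge0 => z _; rewrite mulr_ge0//; have /andP[] := IH z.
rewrite -(P1 x); apply: ler_sum => z _; rewrite ler_piMr//.
by have /andP[] := IH z.
Qed.

(** The first two terms of the series: no jump, or exactly one. *)
Lemma ctrw_transition_ge t x y : 0 <= t ->
  expR (- t) * ((x == y)%:R + t * P x y) <= ctrw_transition P t x y.
Proof.
move=> t0; rewrite /ctrw_transition; set u := fun k => _.
have u0 k : 0 <= u k.
  rewrite /u mulr_ge0 ?divr_ge0 ?mulr_ge0 ?expR_ge0 ?exprn_ge0//.
  by have /andP[] := iter_kernel_itv k x y.
have cu : cvgn (series u).
  apply: (@series_le_cvg _ u (expR (- t) *: exp_coeff t)) => //.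
  - by move=> k; rewrite /= mulr_ge0 ?expR_ge0 ?exp_coeff_ge0.
  - move=> k; rewrite /u /= -mulrA -mulrA ler_wpM2l ?expR_ge0//.
    rewrite /exp_coeff/= mulrA ler_piMr ?divr_ge0 ?exprn_ge0//.
    by have /andP[] := iter_kernel_itv k x y.
  - by apply: is_cvg_seriesZ; exact: is_cvg_series_exp_coeff.
have -> : expR (- t) * ((x == y)%:R + t * P x y) = series u 2.
  rewrite /series/= !big_nat_recl// big_geq// /u/= (bigD1 y)//= big1 => [|z].
    by rewrite eqxx factS fact0 muln1 mulr1n; field.
  by move=> /negPf ->; rewrite mulr0.
by apply: nondecreasing_cvgn_le => //; exact: nondecreasing_series.
Qed.

Definition pair_transition t (u v : V * V) : R :=
  ctrw_transition P t u.1 v.1 * ctrw_transition P t u.2 v.2.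

(** As [D] is nonnegative, the transition probabilities may be replaced by their
    lower bounds, whose product is [(1 - t) ^ 2 (I + t P) (x) (I + t P)].
    Dropping the term [t ^ 2 P (x) P] leaves
    [(1 - t) ^ 2 (D + t (P D + D P^T)) >= (1 - t) ^ 2 ((1 + 2 t) D - t p)], and
    [(1 - t) ^ 2 (1 + 2 t) >= 1 - 4 t ^ 2]. *)
Lemma pair_transition_drift (D : V -> V -> R) (p t : R) u :
  (forall x y, 0 <= D x y <= 1) -> 0 <= p ->
  (forall x y, 2 * D x y <=
     p + \sum_z P x z * D z y + \sum_z P y z * D x z) ->
  0 <= t <= 2^-1 ->
  D u.1 u.2 - (p * t + 4 * t ^+ 2) <=
  \sum_v pair_transition t u v * D v.1 v.2.
Proof.
move: u => [x y] D01 p0 DP /andP[t0 t2] /=; have [P0 P1] := P_stoch.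
have D0 a b : 0 <= D a b by have /andP[] := D01 a b.
have t1 : 0 <= 1 - t by lra.
pose s a b := (a == b)%:R + t * P a b.
have s0 a b : 0 <= s a b by rewrite addr_ge0// mulr_ge0.
have q_ge a b : (1 - t) * s a b <= ctrw_transition P t a b.
  apply: le_trans (ctrw_transition_ge a b t0); rewrite ler_wpM2r//.
  by have := expR_ge1Dx (- t); lra.
have sum_s a (g : V -> R) : \sum_b s a b * g b = g a + t * \sum_b P a b * g b.
  under eq_bigr do rewrite mulrDl -mulrA.
  rewrite big_split/= -big_distrr/=; congr (_ + _).
  by under eq_bigr do rewrite eq_sym; exact: sum_indicator.
have : (1 - t) ^+ 2 * \sum_a s x a * \sum_b s y b * D a b <=
    \sum_v pair_transition t (x, y) v * D v.1 v.2.
  rewrite -(pair_bigA _ (fun a b => pair_transition t (x, y) (a, b) * D a b))/=.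
  rewrite big_distrr/=; apply: ler_sum => a _.
  rewrite !big_distrr/=; apply: ler_sum => b _; rewrite /pair_transition/=.
  rewrite !mulrA ler_wpM2r// (_ : _ * s y b = (1 - t) * s x a * ((1 - t) * s y b)).
    by rewrite ler_pM ?mulr_ge0.
  by ring.
apply: le_trans; under eq_bigr do rewrite sum_s.
rewrite sum_s.
have Ds : 0 <= \sum_a P x a * (\sum_b P y b * D a b).
  by apply: sumr_ge0 => a _; rewrite mulr_ge0// sumr_ge0// => b _; rewrite mulr_ge0.
under [X in _ + t * X]eq_bigr do rewrite mulrDr mulrCA.
rewrite big_split/= -big_distrr/=.
have /andP[Dxy0 Dxy1] := D01 x y; have := DP x y.
set K1 := \sum_z P x z * _; set K2 := \sum_z P y z * _.
move: Ds; set K3 := \sum_a _ => K3ge0 DPxy.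
have c0 : 0 <= (1 - t) ^+ 2 by exact: sqr_ge0.
have step : (1 - t) ^+ 2 * (D x y * (1 + 2 * t) - t * p) <=
    (1 - t) ^+ 2 * (D x y + t * K2 + t * (K1 + t * K3)).
  rewrite ler_wpM2l//.
  have := mulr_ge0 t0 (mulr_ge0 t0 K3ge0).
  have : t * (2 * D x y) <= t * (p + K1 + K2) by rewrite ler_wpM2l.
  by lra.
apply: le_trans step.
have h1 : (1 - 2 * t) * (1 + 2 * t) * D x y <= (1 - t) ^+ 2 * (1 + 2 * t) * D x y.
  by rewrite ler_wpM2r// ler_wpM2r//; [lra|have := sqr_ge0 t; lra].
have h2 : (1 - t) ^+ 2 * (t * p) <= 1 * (t * p).
  by rewrite ler_wpM2r ?mulr_ge0//; have := mulr_ge0 t0 t1; lra.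
have h3 : 4 * t ^+ 2 * D x y <= 4 * t ^+ 2 * 1.
  by rewrite ler_wpM2l// mulr_ge0// sqr_ge0.
by lra.
Qed.

End ContinuousTimeWalk.

(** * Stopping at the meeting time *)

(** The integral of a nonnegative function is the supremum of those of the simple
    functions below it, hence monotone on arbitrary functions; in this way step
    functions bound the expected meeting time from below. *)
Lemma integral_mono_ge0 (R : realType) (d : measure_display)
    (T : measurableType d) (mu : {measure set T -> \bar R}) (f g : T -> \bar R) :
  (forall w, (0 <= f w)%E) -> (forall w, (f w <= g w)%E) ->
  (\int[mu]_w f w <= \int[mu]_w g w)%E.
Proof.
move=> f0 fg; rewrite !ge0_integralTE// => [|w]; last exact: le_trans (fg w).
by apply: ereal_sup_le => _ [u /= uf <-]; exists u => // w; exact: le_trans (fg w).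
Qed.

Lemma sum_block_le (R : realType) (f : nat -> R) (n K : nat) :
  (forall l l', (l <= l')%N -> f l' <= f l) ->
  \sum_(l < K * n) f l <= n%:R * \sum_(i < K) f (i * n)%N.
Proof.
move=> fn; elim: K => [|K IH]; first by rewrite mul0n !big_ord0 mulr0.
rewrite mulSn addnC big_split_ord/= big_ord_recr/= mulrDr lerD//.
rewrite mulr_natl -[X in _ *+ X]card_ord -sumr_const; apply: ler_sum => i _.
by apply: fn; exact: leq_addr.
Qed.

Section MeetingTime.
Context (R : realType) (V : finType) (P : V -> V -> R) (pi_ : V -> R)
  (d : measure_display) (T : measurableType d) (Pr : probability T R)
  (X Y : R -> T -> V).
Hypothesis X_walk : ct_random_walk Pr P pi_ X.
Hypothesis Y_walk : ct_random_walk Pr P pi_ Y.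
Hypothesis XY_indep : independent_processes Pr X Y.

Definition grid_pair (t : R) (i : nat) (w : T) : V * V :=
  (X (i%:R * t) w, Y (i%:R * t) w).

Lemma measurable_grid_pair t i u : 0 <= t ->
  measurable (grid_pair t i @^-1` [set u]).
Proof.
move=> t0; have it0 : 0 <= i%:R * t by rewrite mulr_ge0.
have [mX _ _] := X_walk; have [mY _ _] := Y_walk.
rewrite (_ : _ @^-1` _ = X (i%:R * t) @^-1` [set u.1] `&` Y (i%:R * t) @^-1` [set u.2]).
  by apply: measurableI; [exact: mX|exact: mY].
apply/seteqP; split=> w; rewrite /grid_pair /=; first by move=> <-.
by case: u => a b /= [-> ->].
Qed.

Lemma process_sigma_algebra_grid (Z : R -> T -> V) (t : R) (k : nat)
    (z : nat -> V) : 0 <= t ->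
  process_sigma_algebra Z
    [set w | forall i, (i <= k)%N -> Z (i%:R * t) w = z i].
Proof.
move=> t0; rewrite /process_sigma_algebra; set G := [set A | _].
rewrite (_ : mkset _ = \bigcap_(i in `I_k.+1) Z (i%:R * t) @^-1` [set z i]).
  apply: (@bigcap_measurableType _ (g_sigma_algebraType G)) => i _.
  apply: sub_sigma_algebra; exists (i%:R * t), (z i); split => //.
  by rewrite mulr_ge0.
by apply/seteqP; split.
Qed.

Lemma walk_grid_law (Z : R -> T -> V) (t : R) (k : nat) (z : nat -> V) :
  ct_random_walk Pr P pi_ Z -> 0 <= t ->
  Pr [set w | forall i, (i <= k)%N -> Z (i%:R * t) w = z i] =
  (pi_ (z 0%N) * \prod_(i < k) ctrw_transition P t (z i) (z i.+1))%:E.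
Proof.
move=> [_ _ fdd] t0.
rewrite (_ : mkset _ = \bigcap_(i in `I_k.+1) Z (i%:R * t) @^-1` [set z i]).
  rewrite (fdd k (fun i => i%:R * t)) ?mul0r// => [|i _].
    congr (_ * _)%:E; apply: eq_bigr => i _; congr ctrw_transition.
    by rewrite -mulrBl -natrB// subSnn mul1r.
  by rewrite ler_wpM2r// ler_nat.
by apply/seteqP; split.
Qed.

Definition pair_law (u : V * V) : R := pi_ u.1 * pi_ u.2.

Lemma grid_pair_law (t : R) (k : nat) (z : nat -> V * V) : 0 <= t ->
  Pr [set w | forall i, (i <= k)%N -> grid_pair t i w = z i] =
  (pair_law (z 0%N) * \prod_(i < k) pair_transition P t (z i) (z i.+1))%:E.
Proof.
move=> t0.
rewrite (_ : mkset _ =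
    [set w | forall i, (i <= k)%N -> X (i%:R * t) w = (z i).1] `&`
    [set w | forall i, (i <= k)%N -> Y (i%:R * t) w = (z i).2]).
  have -> := XY_indep (process_sigma_algebra_grid (Z:=X) k (fun i => (z i).1) t0)
    (process_sigma_algebra_grid (Z:=Y) k (fun i => (z i).2) t0).
  rewrite (walk_grid_law k (fun i => (z i).1) X_walk t0)//.
  rewrite (walk_grid_law k (fun i => (z i).2) Y_walk t0)//.
  by rewrite -EFinM mulrACA -big_split.
apply/seteqP; split=> [w H|w [HX HY] i ik].
  by split=> i ik /=; rewrite -H.
by rewrite /grid_pair HX// HY// -surjective_pairing.
Qed.

Definition distinct (u : V * V) : bool := u.1 != u.2.

(** No meeting at a time of the grid of mesh [h / 2 ^ j] in [0, i h]. *)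
Definition apart (h : R) (j i : nat) : set T :=
  avoid (grid_pair (h / 2 ^+ j)) distinct (i * 2 ^ j).+1.

Definition apart_at_dyadics (h : R) (i : nat) : set T := \bigcap_j apart h j i.

Lemma measurable_apart h j i : 0 <= h -> measurable (apart h j i).
Proof.
move=> h0; apply: measurable_avoid => l u; apply: measurable_grid_pair.
by rewrite divr_ge0// exprn_ge0.
Qed.

Lemma measurable_apart_at_dyadics h i : 0 <= h -> measurable (apart_at_dyadics h i).
Proof. by move=> h0; apply: bigcapT_measurable => j; exact: measurable_apart. Qed.

(** The dyadic grids are nested, so the events decrease to their intersection. *)
Lemma apart_cvg h i : 0 <= h ->
  fine (Pr (apart h j i)) @[j --> \oo] --> fine (Pr (apart_at_dyadics h i)).
Proof.
move=> h0; apply: fine_cvg; rewrite fineK ?fin_num_measure//; last first.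
  exact: measurable_apart_at_dyadics.
apply: nonincreasing_cvg_mu.
- by rewrite (le_lt_trans (probability_le1 _ _)) ?ltry//; exact: measurable_apart.
- by move=> j; exact: measurable_apart.
- exact: measurable_apart_at_dyadics.
apply/nonincreasing_seqP => j; apply/subsetPset => w H l li.
have -> : grid_pair (h / 2 ^+ j) l w = grid_pair (h / 2 ^+ j.+1) (l * 2) w.
  by rewrite /grid_pair exprS natrM; congr (X _ w, Y _ w); field.
by apply: H; rewrite ltnS expnSr mulnA leq_mul2r -ltnS li.
Qed.

(** If the walks met before time [i h], right-continuity would keep them together
    on a short interval after the meeting, and a fine enough grid has a point
    there. *)
Lemma meeting_time_ge h i w : 0 < h -> apart_at_dyadics h i w ->
  ((i%:R * h)%:E <= meeting_time X Y w)%E.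
Proof.
move=> h0 apart_w; apply: le_ereal_inf_tmp => _ [s [s0 XYs] <-].
rewrite lee_fin leNgt; apply/negP => sih.
have [_ rcX _] := X_walk; have [_ rcY _] := Y_walk.
have [e /= e0 He] : exists2 e : R, 0 < e &
    forall r, s < r -> r < s + e -> X r w = Y r w.
  have [e /= e0 He] := filterI (rcX w s s0) (rcY w s s0).
  exists e => // r sr rse; have [] := He r _ sr.
    by rewrite /ball /= ltr_distlC; apply/andP; split; lra.
  by move=> -> ->.
(* A grid point just after the meeting time [s] and before [i * h]. *)
pose e' := Num.min e (i%:R * h - s).
have e'0 : 0 < e' by rewrite lt_min e0 subr_gt0.
have eh0 : 0 < e' / h by rewrite divr_gt0.
have [j _ /(_ j (leqnn j))/= jlt] := near_infty_natSinv_expn_lt (PosNum eh0).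
pose t := h / 2 ^+ j.
have t0 : 0 < t by rewrite divr_gt0// exprn_gt0.
have te' : t < e' by rewrite /t -[h]mul1r mulrAC -ltr_pdivlMr.
have /andP[lo hi] := truncn_itv (divr_ge0 s0 (ltW t0)).
pose l := (Num.truncn (s / t)).+1.
have sl : s < l%:R * t by rewrite -ltr_pdivrMr.
have ls : l%:R * t <= s + t.
  by rewrite /l -natr1 mulrDl mul1r lerD2r -ler_pdivlMr.
have [te ti] : t < e /\ t < i%:R * h - s by move: te'; rewrite lt_min => /andP.
have li : (l < (i * 2 ^ j).+1)%N.
  rewrite ltnS -(ler_nat R) -(ler_pM2r t0) natrM natrX /t -mulrA.
  rewrite [2 ^+ j * _]mulrC divfK ?expf_neq0//.
  by rewrite -/t; lra.
have := apart_w j I l li; rewrite /distinct /grid_pair /= -/t He//; last by lra.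
by rewrite eqxx.
Qed.

Lemma meeting_time_ge0 w : (0 <= meeting_time X Y w)%E.
Proof. by apply: le_ereal_inf_tmp => _ [s [s0 _] <-]. Qed.

(** The sum of [h] over the [i] in [1, K] with [i h <= M] is at most [M]: the
    lower Riemann sum of [E M = \int Pr (M >= t) dt]. *)
Lemma expected_meeting_time_ge h K : 0 < h ->
  ((h * \sum_(i < K) fine (Pr (apart_at_dyadics h i.+1)))%:E <=
   \int[Pr]_w meeting_time X Y w)%E.
Proof.
move=> h0; pose f w : R := \sum_(i < K) h * \1_(apart_at_dyadics h i.+1) w.
have mA i := measurable_apart_at_dyadics i (ltW h0).
rewrite (_ : _%:E = \int[Pr]_w (f w)%:E)%E.
  apply: integral_mono_ge0 => w.
    by rewrite lee_fin sumr_ge0// => i _; rewrite mulr_ge0// ltW.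
  have := meeting_time_ge0 w.
  have := fun i => @meeting_time_ge h i w h0.
  case: (meeting_time X Y w) => [r| |]; rewrite ?leey// => Ar; rewrite !lee_fin.
  move=> r0; suff : f w <= h * K%:R /\ f w <= r by case.
  rewrite /f; elim: (K) => [|k [IH1 IH2]]; first by rewrite big_ord0 mulr0.
  rewrite big_ord_recr/= indicE; have [|_] := boolP (w \in _).
    rewrite inE => /Ar; rewrite lee_fin !mulr1 -!natr1 => kr; split; lra.
  by rewrite mulr0 addr0 -natr1; split => //; lra.
rewrite /f; under eq_integral do rewrite -sumEFin.
rewrite ge0_integral_sum//=; first last.
- by move=> i w _; rewrite lee_fin mulr_ge0// ltW.
- move=> i; apply/measurable_EFinP; apply: measurable_funM => //;
  exact: measurable_indic.
rewrite big_distrr/= -sumEFin; apply: eq_bigr => i _.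
under eq_integral do rewrite EFinM.
rewrite ge0_integralZl//=; last 2 first.
- by apply/measurable_EFinP; exact: measurable_indic.
- by rewrite lee_fin ltW.
by rewrite integral_indic// setIT EFinM fineK ?fin_num_measure.
Qed.

Lemma le_apart h j i i' : (i <= i')%N -> apart h j i' `<=` apart h j i.
Proof.
move=> ii' w H l li; apply: H; apply: leq_trans li _.
by rewrite ltnS leq_mul2r ii' orbT.
Qed.

Hypothesis P_stoch : stochastic P.
Context (D : V -> V -> R) (p : R).
Hypothesis D01 : forall x y, 0 <= D x y <= 1.
Hypothesis D_diag : forall x, D x x = 0.
Hypothesis D_drift : forall x y,
  2 * D x y <= p + \sum_z P x z * D z y + \sum_z P y z * D x z.
Hypothesis p01 : 0 < p <= 1.

(** Stopping on the grid of mesh [h / 2 ^ j] over [0, K h], with the time spent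
    apart bounded by grouping the steps into blocks of length [h]: the coarse
    bound no longer has a number of terms growing with [j]. *)
Lemma stopping_bound_level (h : R) (K j : nat) : 0 <= h -> h / 2 ^+ j <= 2^-1 ->
  \sum_x \sum_y pi_ x * pi_ y * D x y <=
  fine (Pr (apart h j K))
  + (p * h + 4 * h * (h / 2 ^+ j)) * \sum_(i < K) fine (Pr (apart h j i)).
Proof.
move=> h0; set t := h / 2 ^+ j => t2; have /andP[p0 _] := p01.
have t0 : 0 <= t by rewrite divr_ge0// exprn_ge0.
pose av l := avoid (grid_pair t) distinct l.
have mav l : measurable (av l).
  by apply: measurable_avoid => i u; exact: measurable_grid_pair.
have := @stopped_mean_le _ _ _ Pr _ (grid_pair t) pair_law
  (pair_transition P t) distinct (fun i u => measurable_grid_pair i u t0)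
  (fun k z => grid_pair_law k z t0) (fun u => D u.1 u.2)
  (p * t + 4 * t ^+ 2) (K * 2 ^ j).
rewrite -(pair_bigA _ (fun x y => pair_law (x, y) * D x y))/=.
move=> /(_ (fun u => proj2 (andP (D01 u.1 u.2)))) H.
apply: le_trans (H _ _) _ => {H}.
- by move=> [x y]; rewrite /distinct negbK /= => /eqP ->.
- move=> u; apply: pair_transition_drift => //; first exact: ltW.
  by rewrite t0.
rewrite lerD2l.
have e0 : 0 <= p * t + 4 * t ^+ 2.
  by rewrite addr_ge0 ?mulr_ge0 ?sqr_ge0// ltW.
have av_mono l l' : (l <= l')%N -> fine (Pr (av l'.+1)) <= fine (Pr (av l.+1)).
  move=> ll'; rewrite fine_le ?fin_num_measure// le_measure ?inE//.
  by move=> w H i il; apply: H; exact: leq_trans il _.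
apply: (le_trans (ler_wpM2l e0 (sum_block_le (2 ^ j) K av_mono))).
rewrite mulrA; apply: ler_wpM2r.
  by apply: sumr_ge0 => i _; rewrite fine_ge0.
have hE : h = t * 2 ^+ j by rewrite /t divfK// expf_neq0.
by rewrite natrX hE; lra.
Qed.

Lemma stopping_bound (h : R) (K : nat) : 0 <= h ->
  \sum_x \sum_y pi_ x * pi_ y * D x y <=
  fine (Pr (apart_at_dyadics h K))
  + p * h * \sum_(i < K) fine (Pr (apart_at_dyadics h i)).
Proof.
move=> h0.
have t0 : h / 2 ^+ j @[j --> \oo] --> (0 : R).
  have := @cvg_geometric R h 2^-1; rewrite ger0_norm ?invr_ge0// => H.
  have {}H := H ltac:(lra).
  by under eq_fun do rewrite -exprVn.
apply: (ler_cvg_to (a := \oo) (f := fun=> \sum_x \sum_y pi_ x * pi_ y * D x y)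
  (g := fun j => fine (Pr (apart h j K)) + (p * h + 4 * h * (h / 2 ^+ j)) *
     \sum_(i < K) fine (Pr (apart h j i)))).
- exact: cvg_cst.
- apply: cvgD; first exact: apart_cvg.
  rewrite -[p * h in X in _ --> X]addr0 -[X in _ + X](mulr0 (4 * h)).
  apply: cvgM.
    by apply: cvgD; [exact: cvg_cst|apply: cvgM; [exact: cvg_cst|]].
  by apply: cvg_big => [|i _]; [exact: add_continuous|exact: apart_cvg].
near=> j; apply: stopping_bound_level => //; near: j.
by apply: (cvgr_le _ t0); rewrite invr_gt0.
Unshelve. all: by end_near. Qed.

(** With [b i] the probability of staying apart up to time [i h], the stopping
    bound reads [b K + p h \sum_(i < K) b i], while [h \sum_(1 <= i <= K) b i]
    is at most [E M].  The term [i = 0] costs [p h], and [b K] is small for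
    large [K] because the [b i] decrease; then [h] tends to zero. *)
Lemma pair_mean_le_meeting_time :
  ((\sum_x \sum_y pi_ x * pi_ y * D x y)%:E <=
   p%:E * \int[Pr]_w meeting_time X Y w)%E.
Proof.
have /andP[p0 p1] := p01; have mt0 := meeting_time_ge0.
have mA h i : 0 < h -> measurable (apart_at_dyadics h i).
  by move=> h0; exact/measurable_apart_at_dyadics/ltW.
have := fun h K => @expected_meeting_time_ge h K.
have : (0 <= \int[Pr]_w meeting_time X Y w)%E by exact: integral_ge0.
case: (integral _ _ _) => [E| |] //; last first.
  by move=> _ _; rewrite gt0_muley// leey.
rewrite lee_fin => E0 H; rewrite -EFinM lee_fin; apply/ler_addgt0Pr => e e0.
pose h := e / 2; have h0 : 0 < h by rewrite divr_gt0.
pose b i := fine (Pr (apart_at_dyadics h i)).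
have b1 i : b i <= 1.
  by rewrite -lee_fin fineK ?fin_num_measure ?probability_le1//; exact: mA.
have b_mono i i' : (i <= i')%N -> b i' <= b i.
  move=> ii'; rewrite fine_le ?fin_num_measure ?le_measure ?inE//; try exact: mA.
  by move=> w Aw j _; exact: le_apart (Aw j I).
have b0 i : 0 <= b i by rewrite fine_ge0.
(* Any [K] with [E / (K h) <= h] makes [b K] at most [h]. *)
pose K := (Num.truncn (E / h / h)).+1.
have hb k : h * \sum_(i < k) b i.+1 <= E.
  by rewrite -lee_fin; exact: H.
have hKE : E <= h * (K%:R * h).
  by have := truncnS_gt (E / h / h); rewrite -/K !ltr_pdivrMr// mulrC => /ltW.
have bK : b K <= h.
  have : h * (K%:R * b K) <= h * (K%:R * h).
    apply: le_trans hKE; apply: le_trans (hb K); rewrite (ler_pM2l h0).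
    rewrite mulr_natl -[X in _ *+ X]card_ord -sumr_const; apply: ler_sum => i _.
    by apply: b_mono.
  by rewrite ler_pM2l// ler_pM2l// ltr0n.
apply: le_trans (stopping_bound K (ltW h0)) _.
have sum_b : \sum_(i < K) b i <= 1 + \sum_(i < K) b i.+1.
  rewrite -[X in _ <= X]/(_ + _) /K big_ord_recl/= lerD ?b1//.
  by rewrite [leRHS]big_ord_recr/= lerDl.
have := ler_wpM2l (ltW (mulr_gt0 p0 h0)) sum_b; rewrite -/(b _).
have := ler_wpM2l (ltW p0) (hb K).
have : p * h <= h by rewrite ler_piMl// ltW.
rewrite (_ : e = h + h) /b; last by rewrite /h; lra.
by move: bK; rewrite /b; lra.
Qed.

End MeetingTime.

(** * Laws of finite-valued variables and convergence to a fair coin *)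

Section LawOfFiniteVariable.
Context (R : realType) (d : measure_display) (T : measurableType d)
  (Q : probability T R) (C : finType) (xi : T -> C) (m : C -> R).
Hypothesis xi_law : has_law Q xi m.

Lemma expectation_law (g : C -> R) :
  ('E_Q[g \o xi] = (\sum_c m c * g c)%:E)%E.
Proof.
have mxi c : measurable (xi @^-1` [set c]) by have [] := xi_law c.
rewrite unlock; transitivity
    (\int[Q]_w \sum_c (g c)%:E * (\1_(xi @^-1` [set c]) w)%:E)%E.
  apply: eq_integral => w _; rewrite (bigD1 (xi w))//= big1 => [|c cw].
    by rewrite indicE mem_set// mule1 adde0.
  by rewrite indicE memNset ?mule0// => /= cE; rewrite cE eqxx in cw.
rewrite integral_sum//; last first.
  by move=> c; apply: integrableZl => //; exact: integrable_indic.
rewrite -sumEFin; apply: eq_bigr => c _.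
rewrite integralZl//; last exact: integrable_indic.
rewrite integral_indic// setIT mulrC EFinM; congr (_ * _)%E.
by have [] := xi_law c.
Qed.

Lemma variance_law (g : C -> R) (mu : R) : \sum_c m c * g c = mu ->
  ('V_Q[g \o xi] = (\sum_c m c * (g c - mu) ^+ 2)%:E)%E.
Proof.
move=> gmu; rewrite /variance unlock expectation_law gmu/=.
exact: (expectation_law (fun c => (g c - mu) ^+ 2)).
Qed.

End LawOfFiniteVariable.

Lemma fair_coin_law (R : realType) :
  has_law (bernoulli_prob (2^-1 : R)) (@idfun bool) (fun=> 2^-1).
Proof.
move=> b; split=> //; rewrite (_ : _ @^-1` _ = [set b])//.
have half01 : 0 <= (2^-1 : R) <= 1 by apply/andP; split; lra.
apply: (etrans (bernoulli_probE half01 [set b])).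
by rewrite !diracE !classical_sets.in_set1 /unstable.onem -!EFinM -EFinD;
  case: b => /=; congr (_%:E); field.
Qed.

(** Near [a] continuity gives [e]; away from [a] the bound [2 B] is absorbed by a
    multiple of the distance. *)
Lemma continuous_bounded_linear_modulus (R : realType) (f : R -> R) (B a e : R) :
  {for a, continuous f} -> (forall x, `|f x| <= B) -> 0 < e ->
  exists2 C, 0 <= C & forall x, `|f x - f a| <= e + C * `|x - a|.
Proof.
move=> fa fB e0; have B0 : 0 <= B := le_trans (normr_ge0 _) (fB 0).
have /cvgrPdist_le/(_ e e0)/nbhs_ballP[r /= r0 Hr] := fa.
exists (2 * B / r) => [|x]; first by rewrite divr_ge0 ?mulr_ge0// ltW.
have [xr|xr] := ltP `|x - a| r.
  have := Hr x; rewrite /ball/= distrC => /(_ xr) /=; rewrite distrC => H.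
  by apply: le_trans H _; rewrite lerDl mulr_ge0// divr_ge0 ?mulr_ge0// ltW.
have h1 : `|f x - f a| <= 2 * B.
  by rewrite (le_trans (ler_normB _ _))// mulr_natl mulr2n lerD.
have h2 : 2 * B <= 2 * B / r * `|x - a|.
  by rewrite -mulrA ler_peMr ?mulr_ge0// mulrC ler_pdivlMr// mul1r.
by lra.
Qed.

(** The distance to the chord is [(1 - s) (f s - f 0) + s (f s - f 1)] in absolute
    value, where the modulus at [0] is at most [e + C s] and the one at [1] is
    at most [e + C (1 - s)]. *)
Lemma chord_distance_le (R : realType) (f : R -> R) (B e : R) :
  continuous f -> (forall x, `|f x| <= B) -> 0 < e ->
  exists2 C, 0 <= C & forall s, 0 <= s <= 1 ->
    `|f s - ((1 - s) * f 0 + s * f 1)| <= e + C * (s * (1 - s)).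
Proof.
move=> cf fB e0.
have [C0 C00 H0] := continuous_bounded_linear_modulus (cf 0) fB e0.
have [C1 C10 H1] := continuous_bounded_linear_modulus (cf 1) fB e0.
exists (C0 + C1) => [|s /andP[s0 s1]]; first by rewrite addr_ge0.
have r0 : 0 <= 1 - s by lra.
have -> : f s - ((1 - s) * f 0 + s * f 1) =
  (1 - s) * (f s - f 0) + s * (f s - f 1) by ring.
apply: le_trans (ler_normD _ _) _; rewrite !normrM (ger0_norm r0) (ger0_norm s0).
have := ler_wpM2l r0 (H0 s); have := ler_wpM2l s0 (H1 s).
rewrite subr0 (ger0_norm s0) (distrC s) (ger0_norm r0).
by lra.
Qed.

Lemma cvg_near_EFin (R : realType) (F : nat -> \bar R) (u : nat -> R) (l : R) :
  (\forall n \near \oo, F n = (u n)%:E) -> u n @[n --> \oo] --> l ->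
  F n @[n --> \oo] --> l%:E.
Proof.
move=> Fu ul; have : (u n)%:E @[n --> \oo] --> l%:E.
  by apply: cvg_EFin => //; near=> n.
apply: cvg_trans; apply: near_eq_cvg; near=> n; apply/esym; near: n; exact: Fu.
Unshelve. all: by end_near. Qed.

Theorem proposition6 (R : realType)
    (V : nat -> finType) (P : forall n, V n -> V n -> R)
    (pi_ : forall n, V n -> R) (p : nat -> R)
    (Gamma : forall n, {ffun V n -> bool} -> R)
    (d : nat -> measure_display) (T : forall n, measurableType (d n))
    (Pr : forall n, probability (T n) R)
    (X Y : forall n, R -> T n -> V n)
    (d' : nat -> measure_display) (T' : forall n, measurableType (d' n))
    (Q : forall n, probability (T' n) R)
    (xi : forall n, T' n -> {ffun V n -> bool})
    (cardV : forall n, (1 <= n)%N -> #|V n| = n)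
    (P_stochastic : forall n, (1 <= n)%N -> stochastic (P n))
    (P_irreducible : forall n, (1 <= n)%N -> irreducible_kernel (P n))
    (pi_stationary : forall n, (1 <= n)%N ->
       stationary_distribution (P n) (pi_ n))
    (p_in01 : forall n, (1 <= n)%N -> 0 < p n <= 1)
    (p_nonincreasing : forall m n, (1 <= m)%N -> (m <= n)%N -> p n <= p m)
    (Gamma_stationary : forall n, (1 <= n)%N ->
       stationary_distribution (nvm_kernel (P n) (p n)) (Gamma n))
    (xi_law : forall n, (1 <= n)%N -> has_law (Q n) (xi n) (Gamma n))
    (X_walk : forall n, (1 <= n)%N ->
       ct_random_walk (Pr n) (P n) (pi_ n) (X n))
    (Y_walk : forall n, (1 <= n)%N ->
       ct_random_walk (Pr n) (P n) (pi_ n) (Y n))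
    (XY_independent : forall n, (1 <= n)%N ->
       independent_processes (Pr n) (X n) (Y n))
    (pEM_to0 :
       ((p n)%:E * \int[Pr n]_w meeting_time (X n) (Y n) w)%E
         @[n --> \oo] --> 0%E) :
  let S n (w : T' n) : R := weighted_opinion (pi_ n) (xi n w) in
  ('V_(Q n)[S n] @[n --> \oo] --> (4^-1 : R)%:E) /\
  cvg_in_distribution Q S (bernoulli_prob (2^-1 : R)) (fun b : bool => b%:R).
Proof.
move=> S.
pose s n (c : {ffun V n -> bool}) : R := weighted_opinion (pi_ n) c.
pose v n : R := \sum_c Gamma n c * (s n c * (1 - s n c)).
have v0 n : (1 <= n)%N -> 0 <= v n.
  move=> n1; have [G0 _ _] := Gamma_stationary n n1; apply: sumr_ge0 => c _.
  have /andP[s0 s1] := weighted_opinion_itv (pi_stationary n n1) c.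
  by rewrite mulr_ge0// mulr_ge0// subr_ge0.
have mean n : (1 <= n)%N -> \sum_c Gamma n c * s n c = 2^-1.
  move=> n1; apply: mean_weighted_opinion (pi_stationary n n1) => //.
  - by rewrite cardV.
  - exact: P_stochastic.
  - exact: Gamma_stationary.
  - exact: p_in01.
have v_le n : (1 <= n)%N ->
    ((2 * v n)%:E <= (p n)%:E * \int[Pr n]_w meeting_time (X n) (Y n) w)%E.
  move=> n1; have Gn := Gamma_stationary n n1.
  rewrite /v (mean_weighted_opinion_variation _ (pi_stationary n n1)).
  apply: (pair_mean_le_meeting_time (X_walk n n1)) => //.
  - exact: Y_walk.
  - exact: XY_independent.
  - exact: P_stochastic.
  - by move=> x y; rewrite (disagreement_ge0 Gn) (disagreement_le1 Gn).
  - by move=> x; exact: disagreement_diag.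
  - apply: disagreement_drift => //; [by rewrite cardV|exact: P_stochastic|exact: p_in01].
  - exact: p_in01.
have v_to0 : v n @[n --> \oo] --> (0 : R).
  have /fine_cvgP[fin_pM pM0] := pEM_to0.
  apply: (squeeze_cvgr _ (cvg_cst 0) pM0).
  near=> n; have n1 : (1 <= n)%N by near: n; exact: nbhs_infty_ge.
  rewrite v0//=; apply: (@le_trans _ _ (2 * v n)).
    by have := v0 n n1; lra.
  rewrite -lee_fin fineK ?v_le//; near: n; exact: fin_pM.
split.
  apply: (@cvg_near_EFin _ _ (fun n => 4^-1 - v n)); last first.
    by rewrite -[X in _ --> X]subr0; apply: cvgB => //; exact: cvg_cst.
  near=> n; have n1 : (1 <= n)%N by near: n; exact: nbhs_infty_ge.
  have [_ G1 _] := Gamma_stationary n n1.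
  rewrite (variance_law (xi_law n n1) (mean n n1)); congr (_%:E).
  have -> : 4^-1 = \sum_c Gamma n c * 4^-1 by rewrite -big_distrl/= G1 mul1r.
  by rewrite -sumrB; apply: eq_bigr => c _; field.
move=> f cf [B fB].
rewrite (expectation_law (fair_coin_law R) (fun b => f b%:R)).
apply: (cvg_near_EFin (u := fun n => \sum_c Gamma n c * f (s n c))).
  near=> n; have n1 : (1 <= n)%N by near: n; exact: nbhs_infty_ge.
  exact: (expectation_law (xi_law n n1) (f \o s n)).
rewrite big_bool/=; apply/cvgrPdist_le => e e0.
have e20 : 0 < e / 2 by rewrite divr_gt0.
have [C C0 HC] := chord_distance_le cf fB e20.
have Cv : \forall n \near \oo, C * v n <= e / 2.
  have Cv0 : C * v n @[n --> \oo] --> C * 0.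
    by apply: cvgM => //; exact: cvg_cst.
  by apply: (cvgr_le _ Cv0); rewrite mulr0.
near=> n; have n1 : (1 <= n)%N by near: n; exact: nbhs_infty_ge.
have [G0 G1 _] := Gamma_stationary n n1.
have -> : 2^-1 * f 1 + 2^-1 * f 0 =
    \sum_c Gamma n c * ((1 - s n c) * f 0 + s n c * f 1).
  transitivity (\sum_c (Gamma n c * f 0 + Gamma n c * s n c * (f 1 - f 0))).
    by rewrite big_split/= -!big_distrl/= G1 mean//; field.
  by apply: eq_bigr => c _; ring.
rewrite distrC -sumrB; apply: (le_trans (ler_norm_sum _ _ _)).
apply: (@le_trans _ _ (\sum_c Gamma n c * (e / 2 + C * (s n c * (1 - s n c))))).
  apply: ler_sum => c _; rewrite -mulrBr normrM ger0_norm// ler_wpM2l// HC//.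
  exact: weighted_opinion_itv (pi_stationary n n1) c.
under eq_bigr do rewrite mulrDr (mulrCA _ C).
rewrite big_split/= -big_distrl -big_distrr/= G1 mul1r.
have : C * v n <= e / 2 by near: n.
by rewrite -/(v n); lra.
Unshelve. all: by end_near. Qed.
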